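(* Let $\Lambda=(\lambda_n)_{n\in\mathbb{N}^*}$ be a sequence of positive real numbers which is ultimately strictly increasing and satisfies $\lim_{n\to\infty}\lambda_n=+\infty$. Then $$\overline d(\Lambda)\le b(\Lambda),$$ where $\overline d(\Lambda)$ is the upper asymptotic density of $\Lambda$ and $b(\Lambda)$ is its Beurling-Malliavin density.
   Context: $\mathbb{N}^*=\{1,2,3,\dots\}$. For a sequence $\Lambda=(\lambda_n)_{n\in\mathbb{N}^*}$ of positive real numbers, ultimately strictly increasing, with $\lambda_n\to+\infty$: (1) The counting function is $F_\Lambda(t)=\#\{k\in\mathbb{N}^*:\lambda_k\le t\}$ for $t>0$, and $F_\Lambda(0)=0$. The upper asymptotic density of $\Lambda$ is $\overline d(\Lambda)=\limsup_{n\to\infty}F_\Lambda(n)/n\in[0,+\infty]$. (2) The Beurling-Malliavin density $b(\Lambda)\in[0,+\infty]$ is the infimum of the numbers $a\ge 0$ for which there exists a sequence $(n_k)_{k\in\mathbb{N}^*}$ of distinct positive integers such that $\sum_{k=1}^\infty\left|\frac{1}{\lambda_k}-\frac{a}{n_k}\right|<\infty$; if no such $a$ exists, $b(\Lambda)=+\infty$. *)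

(* Defs.v *)
From HB Require Import structures.
From mathcomp Require Import all_boot all_order all_algebra.
From mathcomp Require Import all_classical all_reals all_analysis.

Set Implicit Arguments.
Unset Strict Implicit.
Unset Printing Implicit Defensive.

Import Order.TTheory GRing.Theory Num.Theory.
Import numFieldNormedType.Exports.

Local Open Scope classical_set_scope.
Local Open Scope ring_scope.

(* A sequence indexed by {1, 2, 3, ...} is a function on nat whose value at 0
   is never used. *)

Definition counting_function (R : realType) (lambda : nat -> R) (t : R) :
    \bar R :=
  if 0 < t then counting [set k : nat | (0 < k)%N /\ lambda k <= t] else 0%E.

Definition upper_density (R : realType) (lambda : nat -> R) : \bar R :=
  limn_esup (fun n : nat => counting_function lambda n%:R / n%:R%:E)%E.

Definition BM_admissible (R : realType) (lambda : nat -> R) (a : R) : Prop :=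
  0 <= a /\
  exists m : nat -> nat,
    [/\ forall k, (0 < k)%N -> (0 < m k)%N,
        forall k l, (0 < k)%N -> (0 < l)%N -> m k = m l -> k = l &
        (\sum_(1 <= k <oo) (`|(lambda k)^-1 - a / (m k)%:R|)%:E < +oo)%E].

(* The infimum in the extended reals is +oo when no a is admissible. *)
Definition BM_density (R : realType) (lambda : nat -> R) : \bar R :=
  ereal_inf [set a%:E | a in BM_admissible lambda].

(* Main.v *)
Require Import Defs.
From HB Require Import structures.
From mathcomp Require Import all_boot all_order all_algebra.
From mathcomp Require Import all_classical all_reals all_analysis.
From mathcomp Require Import finmap ring lra zify.

Set Implicit Arguments.
Unset Strict Implicit.
Unset Printing Implicit Defensive.

Import Order.TTheory GRing.Theory Num.Theory.
Import numFieldNormedType.Exports.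

Local Open Scope classical_set_scope.
Local Open Scope ring_scope.

(** The heart of the matter is a Markov inequality on tails.  Let [a] be
admissible, witnessed by distinct positive integers [m k], let [d > 0] and
put [c = a + d].  The indices [k] with [lambda k <= t] are of three kinds:
- those below a fixed threshold [K], which contribute [O(1)] to the count;
- those with [m k <= c * t]: as [m] is injective, at most [c * t] of them
  ([count_injective_le]);
- the others, for which [1 / lambda k - a / m k >= 1 / t - a / (c * t)
  = d / (c * t)].  The sum of [|1 / lambda k - a / m k|] over [k >= K] is at
  most [d * d / c] once [K] is large, so at most [d * t] of these remain
  ([count_markov]).
Hence [F(t) <= K + (a + 2 * d) * t], with [K] independent of [t]; dividing by
[t] and letting [t] tend to infinity bounds the upper density by [a + 3 * d]
for every [d > 0], hence by [a]. *)

Lemma counting_seq (R : realType) (T : choiceType) (A : set T) (s : seq T) :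
  uniq s -> (forall x, A x <-> x \in s) ->
  counting A = (size s)%:R%:E :> \bar R.
Proof.
move=> us As.
have -> : A = [set` [fset x in s]%fset].
  by apply/seteqP; split => x /=; rewrite inE; apply As.
rewrite /counting asboolT; last exact: finite_fset.
by rewrite set_fsetK card_fseq undup_id.
Qed.

(** [m] sends the counted indices injectively into the [truncn x] integers
of [[1, x]]. *)
Lemma count_injective_le (R : realType) (T : eqType) (m : T -> nat) (x : R)
    (s : seq T) :
  0 <= x -> uniq s -> {in s, forall k, (0 < m k)%N} -> {in s &, injective m} ->
  (count (fun k => (m k)%:R <= x) s)%:R <= x.
Proof.
move=> x0 us m0 minj; rewrite -size_filter -truncn_ge_nat//.
set s' := [seq k <- s | _].
have s's : {subset s' <= s} by move=> k; rewrite mem_filter => /andP[].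
rewrite -(size_map m) -[leqRHS](size_iota 1); apply: uniq_leq_size.
  rewrite map_inj_in_uniq ?filter_uniq// => k l ks ls.
  by apply: minj; exact: s's.
move=> _ /mapP[k ks ->]; rewrite mem_iota add1n ltnS m0 ?s's//=.
by rewrite truncn_ge_nat//; move: ks; rewrite mem_filter => /andP[].
Qed.

Lemma count_markov (R : realType) (T : eqType) (P : pred T) (f : T -> R) (w : R)
    (s : seq T) :
  (forall k, 0 <= f k) -> {in s, forall k, P k -> w <= f k} ->
  (count P s)%:R * w <= \sum_(k <- s) f k.
Proof.
move=> f0 wf.
rewrite -sum1_count natr_sum mulr_suml big_mkcond/= big_seq [leRHS]big_seq.
by apply: ler_sum => k ks; case: ifPn => [/(wf _ ks)|_]; rewrite ?mul1r.
Qed.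

(** Finite sections of the tail are bounded instead of the tail itself, since
only finitely many indices are ever counted.  Asking for [0 < K] keeps the
tail away from the index [0], on which the convergent series says nothing. *)
Lemma small_tail (R : realType) (f : nat -> R) (e : R) :
  (forall k, 0 <= f k) -> (\sum_(1 <= k <oo) (f k)%:E < +oo)%E -> 0 < e ->
  exists2 K, (0 < K)%N & forall M, \sum_(K <= k < M) f k <= e.
Proof.
move=> f0 fcvg e0.
have fE k : (0 <= (f k)%:E)%E by rewrite lee_fin.
have shifted : (\sum_(0 <= k <oo) (f (k + 1)%N)%:E < +oo)%E.
  by rewrite (@nneseries_addn _ (fun k => (f k)%:E)).
have /fine_cvgP[fin /cvgrPdist_le /(_ _ e0) small] :=
  nneseries_tail_cvg shifted (fun k _ => fE (k + 1)%N).
near \oo => N.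
exists N.+1 => // M.
have finN : (\sum_(N <= k <oo) (f (k + 1)%N)%:E)%E \is a fin_num by near: N.
have : `|0 - fine (\sum_(N <= k <oo) (f (k + 1)%N)%:E)%E| <= e by near: N.
rewrite sub0r normrN => /(le_trans (ler_norm _)); apply: le_trans.
rewrite -lee_fin fineK//.
have [MN|NM] := leqP M N.
  by rewrite big_geq ?(leq_trans MN)//; apply: nneseries_ge0.
case: M NM => // M NM.
rewrite big_add1 /= -sumEFin; under eq_bigr do rewrite -addn1.
by apply: nneseries_lim_ge.
Unshelve. all: by end_near.
Qed.

(** The set of good indices is itself one of the neighbourhoods of infinity
over which the limit superior takes an infimum. *)
Lemma limn_esup_le_near (R : realType) (u : nat -> \bar R) (l : \bar R) :
  (\forall n \near \oo, u n <= l)%E -> (limn_esup u <= l)%E.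
Proof.
move=> ul; rewrite /limn_esup limf_esupE.
apply: (@le_trans _ _ (ereal_sup (u @` [set n | u n <= l]%E))).
  by apply: ereal_inf_lbound; exists [set n | u n <= l]%E.
by apply: ge_ereal_sup => _ [n /= un <-].
Qed.

(** The threshold [K] depends on [a] and [d] but not on [t]: this uniformity
makes its contribution vanish in the density. *)
Lemma counting_function_le (R : realType) (lambda : nat -> R) (a d : R) :
  (forall n : nat, (0 < n)%N -> 0 < lambda n) ->
  lambda n @[n --> \oo] --> +oo ->
  BM_admissible lambda a -> 0 < d ->
  exists K : nat, forall t : R, 0 < t ->
    (counting_function lambda t <= (K%:R + (a + d + d) * t)%:E)%E.
Proof.
move=> lambda_gt0 lambda_cvg [a0 [m [m0 minj mcvg]]] d0.
pose c := a + d; have c0 : 0 < c by rewrite /c; lra.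
pose f k := `|(lambda k)^-1 - a / (m k)%:R|.
have f0 k : 0 <= f k by exact: normr_ge0.
(* A term counted in the tail is at least [d / (c * t)], so this bound on the
   tail leaves room for exactly [d * t] of them. *)
have e0 : 0 < d * d / c by rewrite divr_gt0// mulr_gt0.
have [K K0 tailK] := small_tail f0 mcvg e0.
exists K => t t0; rewrite /counting_function t0.
(* As [lambda] tends to infinity, only indices below some [N] are counted at
   level [t]; taking [N >= K] lets the range be cut at [K]. *)
have [N0 _ N0P] : \forall n \near \oo, t < lambda n by move/cvgryPgt : lambda_cvg.
pose N := maxn K N0; pose P k := lambda k <= t.
have KN : (K <= N)%N by exact: leq_maxl.
rewrite (@counting_seq _ _ _ [seq k <- index_iota 1 N | P k]); first last.
- move=> k; rewrite mem_filter mem_index_iota; split=> [[k0 kt]|].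
    rewrite /P kt k0/= ltnNge; apply/negP => Nk; move: kt; rewrite leNgt N0P//=.
    by rewrite (leq_trans _ Nk)// leq_maxr.
  by move=> /andP[? /andP[]].
- exact/filter_uniq/iota_uniq.
rewrite lee_fin size_filter.
pose s := index_iota K N; pose Q k := (m k)%:R <= c * t.
pose S k := P k && ~~ Q k.
have sK k : k \in s -> (K <= k)%N by rewrite mem_index_iota => /andP[].
have spos k : k \in s -> (0 < k)%N by move=> /sK; exact: leq_trans.
have -> : (count P (index_iota 1 N)
    = count P (index_iota 1 K) + count P s)%N.
  rewrite -count_cat /s /index_iota -[in X in _ ++ iota X _](subnKC K0).
  by rewrite -iotaD; congr (count _ (iota _ _)); lia.
have head : (count P (index_iota 1 K) <= K)%N.
  by rewrite (leq_trans (count_size _ _))// size_iota leq_subr.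
have split_s : (count P s <= count Q s + count S s)%N.
  rewrite -(count_predUI Q) (leq_trans _ (leq_addr _ _))//.
  by apply: sub_count => k /= Pk; rewrite /S Pk orbN.
have countQ : (count Q s)%:R <= c * t.
  apply: count_injective_le; rewrite ?iota_uniq//.
  - by rewrite mulr_ge0// ltW.
  - by move=> k /spos; exact: m0.
  - by move=> k l /spos k0 /spos l0; exact: minj.
have countPQ : (count S s)%:R <= d * t.
  have w0 : 0 < d / (c * t) by rewrite divr_gt0// mulr_gt0.
  rewrite -(ler_pM2r w0) [leRHS](_ : _ = d * d / c); last first.
    by field; rewrite !gt_eqF.
  apply: le_trans (tailK N); apply: count_markov => // k /spos k0.
  rewrite /S /P /Q -ltNge => /andP[lk mk].
  apply: le_trans (ler_norm _).
  have -> : d / (c * t) = t^-1 - a / (c * t).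
    by rewrite /c; field; rewrite -/c !gt_eqF.
  apply: lerB; first by rewrite lef_pV2// posrE lambda_gt0.
  by rewrite ler_wpM2l// lef_pV2 ?posrE ?(ltW mk)// ?mulr_gt0// ltr0n m0.
rewrite -(ler_nat R) natrD in split_s; rewrite -(ler_nat R) in head.
by rewrite natrD; move: countQ; rewrite /c; lra.
Qed.

Theorem theorem4p1 (R : realType) (lambda : nat -> R)
    (lambda_gt0 : forall n : nat, (0 < n)%N -> 0 < lambda n)
    (lambda_incr : \forall n \near \oo, lambda n < lambda n.+1)
    (lambda_cvg : lambda n @[n --> \oo] --> +oo) :
  (upper_density lambda <= BM_density lambda)%E.
Proof.
apply: le_ereal_inf_tmp => _ [a adm <-].
apply/lee_addgt0Pr => e e0; rewrite -EFinD.
(* Of the three thirds of [e], two are the loss in the bound on the count,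
   the last absorbs the constant [K]. *)
have d0 : 0 < e / 3 by lra.
have [K FK] := counting_function_le lambda_gt0 lambda_cvg adm d0.
apply: limn_esup_le_near.
near=> n.
have n0 : 0 < n%:R :> R by rewrite ltr0n; near: n; exact: nbhs_infty_gt.
have Kn : K%:R <= e / 3 * n%:R.
  rewrite mulrC -ler_pdivrMr//; near: n; exact: nbhs_infty_ger.
rewrite inver gt_eqF// lee_pdivrMr// (le_trans (FK _ n0))// -EFinM lee_fin.
nra.
Unshelve. all: by end_near.
Qed.
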